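(* Let $\{\mathcal S_j\}_{j=1}^{n_s}$ be a dictionary of shapes in $D$ and $\Sigma\subset D$. Suppose the lucid object condition holds for $\Sigma$ and there exists at least one composition of the dictionary elements, given by index sets $\mathcal I_\oplus,\mathcal I_\ominus\subset\{1,\dots,n_s\}$, for which $\Sigma=\mathrm{cl}(\mathcal R_{\mathcal I_\oplus,\mathcal I_\ominus})$. Then $\alpha^*\in\mathbb R^{n_s}$ minimizes (over $\alpha\in\mathbb R^{n_s}$) the cost $$\int_D\max\Big(\big(\Pi_{in}(x)-\Pi_{ex}(x)\big)\mathcal L_\alpha(x),\ \big(\Pi_{in}(x)-\Pi_{ex}(x)\big)^-\Big)\,dx$$ if and only if $$\mathcal L_{\alpha^*}(x)\ge 1\ \text{ for } x\in\mathrm{int}(\Sigma)\qquad\text{and}\qquad\mathcal L_{\alpha^*}(x)\le 0\ \text{ for } x\in\mathrm{int}(D\setminus\Sigma).$$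
   Context: $D\subset\mathbb R^d$ is the imaging domain; $\mathrm{cl}$ and $\mathrm{int}$ denote closure and interior. $\Pi_{in},\Pi_{ex}$ are fixed, known functions on $D$ (image-dependent inhomogeneity measures) with $\Pi_{in}(x)\ge0$ and $\Pi_{ex}(x)\ge0$ for all $x\in D$. A shape is a closed set $\mathcal S\subset D$ which is not a null set, i.e. has positive Lebesgue measure (a property equivalently expressed as $\mathrm{int}(\mathcal S)\neq\emptyset$). The composition associated with index sets $\mathcal I_\oplus,\mathcal I_\ominus$ is $\mathcal R_{\mathcal I_\oplus,\mathcal I_\ominus}=\big(\bigcup_{j\in\mathcal I_\oplus}\mathcal S_j\big)\setminus\big(\bigcup_{j\in\mathcal I_\ominus}\mathcal S_j\big)$. For $\alpha\in\mathbb R^{n_s}$, $\mathcal L_\alpha(x)=\sum_{j=1}^{n_s}\alpha_j\chi_{\mathcal S_j}(x)$, where $\chi_{\mathcal S}$ is the characteristic function of $\mathcal S$ (1 on $\mathcal S$, 0 off $\mathcal S$). For a function $\Pi$, $\Pi^-$ equals $\Pi$ where $\Pi<0$ and zero otherwise. The lucid object condition (LOC) holds for $\Sigma\subset D$ if $\Pi_{in}(x)<\Pi_{ex}(x)$ for $x\in\Sigma$ and $\Pi_{in}(x)>\Pi_{ex}(x)$ for $x\in D\setminus\Sigma$.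
   Formalization: The conditions on L_{α*} are stated for almost every x of int(Σ) and int(D∖Σ), not every x; each shape S and the domain D are assumed to have S∖int(S), D∖int(D) of measure zero; D is measurable and Π_in−Π_ex integrable on D. *)

(* Defs.v *)
From HB Require Import structures.
From mathcomp Require Import all_boot all_order all_algebra.
From mathcomp Require Import all_classical all_reals all_analysis.

Set Implicit Arguments.
Unset Strict Implicit.
Unset Printing Implicit Defensive.
Import Order.TTheory GRing.Theory Num.Theory.
Import numFieldNormedType.Exports.

Local Open Scope classical_set_scope.
Local Open Scope ring_scope.

(* Lebesgue measure on R^d, obtained by Caratheodory's construction from the
   outer measure of countable covers by closed boxes. It lives on the
   (complete) sigma-algebra of Lebesgue measurable sets.                      *)

Section lebesgue_outer.
Context {R : realType} {d : nat}.

(* [None] stands for the empty box: it is needed in dimension 0, where every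
   [box (Some _)] is the whole space and has volume 1.                        *)
Definition box (ab : option ('rV[R]_d * 'rV[R]_d)) : set 'rV[R]_d :=
  if ab is Some (a, b)
  then [set x | forall i, a ord0 i <= x ord0 i <= b ord0 i] else set0.

Definition box_volume (ab : option ('rV[R]_d * 'rV[R]_d)) : \bar R :=
  if ab is Some (a, b)
  then (\prod_(i < d) Num.max (b ord0 i - a ord0 i) 0)%:E else 0%E.

Definition lebesgue_outer (X : set 'rV[R]_d) : \bar R :=
  ereal_inf [set (\sum_(k <oo) box_volume (ab k))%E
            | ab in [set ab | X `<=` \bigcup_k box (ab k)]].

Local Open Scope ereal_scope.

Let box_volume_ge0 ab : 0 <= box_volume ab.
Proof.
case: ab => [[a b]|//=]; rewrite lee_fin; apply: prodr_ge0 => i _.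
by rewrite le_max lexx orbT.
Qed.

Let lebesgue_outer_ge0 X : 0 <= lebesgue_outer X.
Proof. by apply: le_ereal_inf_tmp => _ [ab _ <-]; exact: nneseries_ge0. Qed.

Let lebesgue_outer0 : lebesgue_outer set0 = 0.
Proof.
apply/eqP; rewrite eq_le lebesgue_outer_ge0 andbT.
by apply: ereal_inf_lbound; exists (fun=> None) => //; rewrite eseries0.
Qed.

Let le_lebesgue_outer : {homo lebesgue_outer : A B / A `<=` B >-> A <= B}.
Proof.
move=> A B AB; apply/ereal_inf_le_tmp => _ [ab /= Bab <-].
by exists ab => //; exact: subset_trans AB Bab.
Qed.

Let lebesgue_outer_sigma_subadditive : sigma_subadditive lebesgue_outer.
Proof.
move=> A; have [[i ioo]|] := pselect (exists i, lebesgue_outer (A i) = +oo).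
  by rewrite (eseries_pinfty _ _ ioo) ?leey// => n _;
    rewrite -ltNye (lt_le_trans _ (lebesgue_outer_ge0 _)).
rewrite -forallNE => Aoo.
suff add2e (e : {posnum R}) : lebesgue_outer (\bigcup_n A n) <=
    \sum_(i <oo) lebesgue_outer (A i) + e%:num%:E.
  by apply/lee_addgt0Pr => _/posnumP[].
rewrite (le_trans _ (epsilon_trick _ _ _))//.
pose P n (B : nat -> option ('rV[R]_d * 'rV[R]_d)) :=
  A n `<=` \bigcup_k box (B k) /\
  \sum_(k <oo) box_volume (B k) <=
    lebesgue_outer (A n) + (e%:num / (2 ^ n.+1)%:R)%:E.
have [G PG] : {G & forall n, P n (G n)}.
  apply: (@choice _ _ P) => n; rewrite /P.
  have en1 : (0 < e%:num / (2 ^ n.+1)%:R)%R by [].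
  have Afin : lebesgue_outer (A n) \is a fin_num.
    by rewrite ge0_fin_numE// ltey; exact/eqP/Aoo.
  have [_ [B AB <-] /ltW] := lb_ereal_inf_adherent en1 Afin.
  by exists B.
pose vG ij := box_volume (uncurry G ij).
have vG0 ij : 0 <= vG ij by exact: box_volume_ge0.
apply: (@le_trans _ _ (\esum_(ij in setT) vG ij)).
  apply: ereal_inf_lbound => /=.
  have /card_esym/ppcard_eqP[f] := card_nat2.
  exists (uncurry G \o f).
    move=> t [i _ /(PG i).1[j _ Gt]]; exists (f^-1%FUN (i, j)) => //=.
    by rewrite invK ?inE.
  rewrite -(esum_pred_image vG _ xpredT) ?[fun=> _]set_true//.
  by rewrite image_eq.
rewrite (_ : esum _ _ = \sum_(i <oo) \sum_(j <oo) box_volume (G i j)); last first.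
  pose J : nat -> set (nat * nat) := fun i => [set (i, j) | j in setT].
  rewrite (_ : setT = \bigcup_k J k); last first.
    by rewrite predeqE => -[a b]; split => // _; exists a => //; exists b.
  rewrite esum_bigcupT //=; last first.
    apply/trivIsetP => i j _ _ ij.
    rewrite predeqE => -[n m] /=; split => //= -[] [_] _ [<-{n} _].
    by move=> [m' _] [] /esym/eqP; rewrite (negbTE ij).
  rewrite -(image_id [set: nat]) -fun_true esum_pred_image//; last first.
    by move=> n _; exact: esum_ge0.
  apply: eq_eseriesr => /= j _.
  rewrite -(esum_pred_image vG (pair j) predT)//=; last first.
    by move=> ? ? _ _; exact: (@can_inj _ _ _ snd).
  by congr esum; rewrite predeqE => -[a b]; split; move=> [i _ <-]; exists i.
apply: lee_nneseries => [i _ _|i _]; first exact: nneseries_ge0.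
by have [_ GAi] := PG i.
Qed.

HB.instance Definition _ := isOuterMeasure.Build R 'rV[R]_d lebesgue_outer
  lebesgue_outer0 lebesgue_outer_ge0 le_lebesgue_outer
  lebesgue_outer_sigma_subadditive.

End lebesgue_outer.

Definition caratheodory_measure (R : realType) (T : pointedType)
    (mu : {outer_measure set T -> \bar R}) :
  {measure set (caratheodory_type mu) -> \bar R} := mu.

Notation lebesgue_rV R d :=
  (caratheodory_type (@lebesgue_outer R d : {outer_measure set _ -> \bar R})).

Definition lebesgue (R : realType) (d : nat) :
    {measure set (lebesgue_rV R d) -> \bar R} :=
  caratheodory_measure (@lebesgue_outer R d).

Section shapes.
Context {R : realType} {d : nat}.
Implicit Types (D S Sigma : set 'rV[R]_d) (Pin Pex : 'rV[R]_d -> R).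

(* Sets are required to have a null frontier [S `\` S°]. For closed sets this
   is what makes [0 < lebesgue S] equivalent to [S° !=set0] (a Cantor set of
   positive measure is closed with empty interior).                           *)
Definition null_frontier (A : set 'rV[R]_d) : Prop :=
  lebesgue R d (A `\` A°) = 0%E.

Definition imaging_domain D : Prop :=
  measurable (D : set (lebesgue_rV R d)) /\ null_frontier D.

Definition is_shape D S : Prop :=
  [/\ closed S, S `<=` D, (0 < lebesgue R d S)%E & null_frontier S].

Definition composition {n : nat} (S : 'I_n -> set 'rV[R]_d)
    (Iplus Iminus : set 'I_n) : set 'rV[R]_d :=
  (\bigcup_(j in Iplus) S j) `\` (\bigcup_(j in Iminus) S j).

Definition calL {n : nat} (S : 'I_n -> set 'rV[R]_d) (alpha : 'rV[R]_n)
    (x : 'rV[R]_d) : R :=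
  \sum_(j < n) alpha ord0 j * \1_(S j) x.

Definition lucid_object_condition D Pin Pex Sigma : Prop :=
  (forall x, Sigma x -> Pin x < Pex x) /\
  (forall x, (D `\` Sigma) x -> Pex x < Pin x).

(* Signed negative part; the library's [f^\-] is its opposite. *)
Definition neg_part (r : R) : R := if r < 0 then r else 0.

Definition cost D Pin Pex {n : nat} (S : 'I_n -> set 'rV[R]_d)
    (alpha : 'rV[R]_n) : \bar R :=
  \int[lebesgue R d]_(x in D)
    (Num.max ((Pin x - Pex x) * calL S alpha x) (neg_part (Pin x - Pex x)))%:E.

End shapes.

(* Main.v *)
Require Import Defs.
From HB Require Import structures.
From mathcomp Require Import all_boot all_order all_algebra.
From mathcomp Require Import all_classical all_reals all_analysis.
From mathcomp Require Import measurable_realfun.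
From mathcomp Require Import lra.
Set Implicit Arguments.
Unset Strict Implicit.
Unset Printing Implicit Defensive.
Import Order.TTheory GRing.Theory Num.Theory.
Import numFieldNormedType.Exports.
Local Open Scope classical_set_scope.
Local Open Scope ring_scope.

(** Write [p = Pin - Pex] and [L = calL S alpha]. Pointwise, the integrand
    [max (p L) p^-] is at least [p^-]. The lucid object condition makes [p]
    negative on [Sigma] and positive on the rest of [D], so equality holds at a
    point of [Sigma] exactly when [1 <= L] there, and at a point outside [Sigma]
    exactly when [L <= 0]. Hence [\int_D p^-], which is finite, bounds every
    cost from below, and a cost attains it precisely when [L] is almost
    everywhere at least 1 on [Sigma] and at most 0 on its complement in [D]
    ([cost_le_min_costP]). The bound is attained: giving weight 1 to the added
    shapes and weight [-n] to the subtracted ones yields such an [L]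
    ([calL_composition_ge1], [calL_composition_le0]), so the minimizers are
    exactly the [alpha] attaining the bound.

    It remains to pass from [Sigma] and [D \ Sigma] to their interiors, and from
    the composition to its closure [Sigma]. All the sets involved differ only on
    the frontiers of the shapes and of [D] ([composition_frontier]), which are
    null by assumption.

    Integrability of the integrand needs the shapes to be measurable. The measure
    is built from an outer measure by covers with boxes, so this is proved from
    Caratheodory's criterion: halfspaces, then boxes, then open sets as countable
    unions of rational boxes ([open_lebesgue_measurable]). *)

(** * Lebesgue measurability of open and closed sets *)

Section lebesgue_measurable.
Context {R : realType} {d : nat}.
Implicit Types (ab : option ('rV[R]_d * 'rV[R]_d)) (A U : set 'rV[R]_d).

Definition cut_above (i : 'I_d) (c : R) ab : option ('rV[R]_d * 'rV[R]_d) :=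
  if ab is Some (a, b) then
    Some (a, \row_j (if j == i then Num.min (b ord0 j) c else b ord0 j))
  else None.

Definition cut_below (i : 'I_d) (c : R) ab : option ('rV[R]_d * 'rV[R]_d) :=
  if ab is Some (a, b) then
    Some (\row_j (if j == i then Num.max (a ord0 j) c else a ord0 j), b)
  else None.

Lemma box_volume_ge0 ab : (0 <= box_volume ab)%E.
Proof.
case: ab => [[a b]|//=]; rewrite lee_fin; apply: prodr_ge0 => i _.
by rewrite le_max lexx orbT.
Qed.

Lemma box_cut_above i c ab :
  box ab `&` [set x | x ord0 i <= c] `<=` box (cut_above i c ab).
Proof.
case: ab => [[a b]|] x; last by case.
move=> [/= abx xc] j; have /andP[aj jb] := abx j.
by rewrite mxE aj/=; case: eqP => [ji|_]//; rewrite le_min jb/= ji.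
Qed.

Lemma box_cut_below i c ab :
  box ab `&` ~` [set x | x ord0 i <= c] `<=` box (cut_below i c ab).
Proof.
case: ab => [[a b]|] x; last by case.
move=> [/= abx /negP]; rewrite -ltNge => /ltW cx j; have /andP[aj jb] := abx j.
by rewrite mxE jb andbT; case: eqP => [->|_]//; rewrite ge_max cx andbT;
  have /andP[] := abx i.
Qed.

Lemma box_volume_cut i c ab :
  (box_volume (cut_above i c ab) + box_volume (cut_below i c ab) =
   box_volume ab)%E.
Proof.
case: ab => [[a b]|] /=; last by rewrite adde0.
rewrite -EFinD; congr EFin.
rewrite (bigD1 i)//= [X in _ + X](bigD1 i)//= [RHS](bigD1 i)//= !mxE eqxx.
set p := \prod_(j < d | j != i) Num.max (b ord0 j - a ord0 j) 0.
rewrite (_ : \prod_(j < d | j != i) _ = p); last first.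
  by apply: eq_bigr => j /negPf ji; rewrite mxE ji.
rewrite (_ : \prod_(j < d | j != i) _ = p); last first.
  by apply: eq_bigr => j /negPf ji; rewrite mxE ji.
rewrite -mulrDl; congr (_ * p).
move: (a ord0 i) (b ord0 i) => u v.
have [vc|cv] := leP v c; have [uc|cu] := leP u c;
  repeat match goal with |- context [Num.max ?x 0] =>
    have [?|?] := leP x 0 end; lra.
Qed.

(** A cover by boxes is cut by the hyperplane [x_i = c] into two covers by boxes
    of the same total volume, which is the Caratheodory criterion for the
    halfspace. *)
Lemma lebesgue_measurable_halfspace (i : 'I_d) (c : R) :
  measurable ([set x | x ord0 i <= c] : set (lebesgue_rV R d)).
Proof.
apply: le_caratheodory_measurable => X /=.
apply: le_ereal_inf_tmp => _ [ab /= Xab <-].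
under eq_eseriesr do rewrite -(box_volume_cut i c).
rewrite nneseriesD; [|by move=> *; exact: box_volume_ge0..].
apply: leeD; apply: ereal_inf_lbound.
  exists (cut_above i c \o ab) => //= x [/Xab[k _ kx] xc].
  by exists k => //; apply: box_cut_above.
exists (cut_below i c \o ab) => //= x [/Xab[k _ kx] xc].
by exists k => //; apply: box_cut_below.
Qed.

Lemma lebesgue_measurable_box ab :
  measurable (box ab : set (lebesgue_rV R d)).
Proof.
case: ab => [[a b]|]; last exact: measurable0.
(* An open halfspace is the union of the closed ones inside it. *)
have mlt (i : 'I_d) c :
    measurable ([set x | x ord0 i < c] : set (lebesgue_rV R d)).
  rewrite [X in measurable X](_ : _ =
      \bigcup_k [set x : 'rV[R]_d | x ord0 i <= c - k.+1%:R^-1]).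
    by apply: bigcupT_measurable => k; exact: lebesgue_measurable_halfspace.
  apply/seteqP; split=> [x /= xc|x [k _ /= xck]]; last first.
    by rewrite (le_lt_trans xck)// ltrBlDr ltrDl.
  have [k ck] := ltr_add_invr xc; exists k => //=.
  by rewrite lerBrDr ltW.
rewrite (_ : box _ = \bigcap_(i in [set: 'I_d])
    ([set x | x ord0 i <= b ord0 i] `\` [set x | x ord0 i < a ord0 i])).
  apply: fin_bigcap_measurable => // i _.
  by apply: measurableD => //; exact: lebesgue_measurable_halfspace.
apply/seteqP; split=> [x /= abx i _|x abx i].
  by have /andP[ai ib] := abx i; split => //=; apply/negP; rewrite -leNgt.
by have [/= -> /negP] := abx i Logic.I; rewrite -leNgt andbT.
Qed.

Definition rat_box (qr : 'rV[rat]_d * 'rV[rat]_d) : set 'rV[R]_d :=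
  box (Some (map_mx ratr qr.1, map_mx ratr qr.2)).

(** Neighbourhoods of a matrix are products of neighbourhoods of its entries, so
    rational bounds can be chosen coordinate by coordinate. *)
Lemma open_rat_box U x : open U -> U x ->
  exists2 qr, rat_box qr `<=` U & rat_box qr x.
Proof.
move=> Uo Ux; have [P Px PU] : nbhs x U by exact: open_nbhs_nbhs.
have /choice[qr qrP] (j : 'I_d) : exists qr : rat * rat,
    ratr qr.1 <= x ord0 j <= ratr qr.2 /\
    forall y, ratr qr.1 <= y <= ratr qr.2 -> P ord0 j y.
  have /nbhs_ballP[e /= e0 eP] := Px ord0 j.
  have [q] : exists q : rat, ratr q \in `](x ord0 j - e), (x ord0 j)[.
    by apply: rat_in_itvoo; rewrite ltrBlDr ltrDl.
  have [r] : exists r : rat, ratr r \in `](x ord0 j), (x ord0 j + e)[.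
    by apply: rat_in_itvoo; rewrite ltrDl.
  rewrite !in_itv/= => /andP[xr re] /andP[qe qx].
  exists (q, r) => /=; split; first by rewrite !ltW.
  move=> y /andP[qy yr]; apply: eP.
  rewrite /ball/= ltr_distlC.
  by rewrite (lt_le_trans qe)// (le_lt_trans yr).
exists (\row_j (qr j).1, \row_j (qr j).2).
  move=> y qry; apply: PU => i j; rewrite (ord1 i).
  by have := qry j; rewrite !mxE => /(qrP j).2.
by move=> j; rewrite !mxE; exact: (qrP j).1.
Qed.

Lemma open_lebesgue_measurable U :
  open U -> measurable (U : set (lebesgue_rV R d)).
Proof.
move=> Uo.
rewrite (_ : U = \bigcup_qr
    (if `[< rat_box qr `<=` U >] then rat_box qr else set0)).
  apply: countable_bigcupT_measurable; first exact: countableP.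
  move=> qr; case: ifP => _; last exact: measurable0.
  exact: lebesgue_measurable_box.
apply/seteqP; split=> [x Ux|x [qr _]]; last first.
  by case: ifPn => // /asboolP; exact.
by have [qr qrU qrx] := open_rat_box Uo Ux; exists qr => //; rewrite asboolT.
Qed.

Lemma closed_lebesgue_measurable A :
  closed A -> measurable (A : set (lebesgue_rV R d)).
Proof.
move=> Ac; rewrite -[A]setCK; apply: measurableC.
by apply: open_lebesgue_measurable; exact: closed_openC.
Qed.

(** The measure is complete, so a null frontier is negligible even when the
    set itself is not known to be measurable. *)
Lemma null_frontier_negligible A :
  null_frontier A -> (lebesgue R d).-negligible (A `\` A°).
Proof.
move=> A0; apply/negligibleP => //.
apply: le_caratheodory_measurable => /= X.
rewrite (_ : lebesgue_outer (X `&` _) = 0%E) ?add0e.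
  by apply: le_outer_measure; exact: subIsetl.
apply/eqP; rewrite eq_le outer_measure_ge0 andbT -A0.
by apply: le_outer_measure; exact: subIsetr.
Qed.

End lebesgue_measurable.

(** * Frontiers of compositions *)

Section composition_frontier.
Context {R : realType} {d n : nat}.
Implicit Types (D : set 'rV[R]_d) (S : 'I_n -> set 'rV[R]_d).

(** Around a point lying on none of the frontiers, every [S j] is locally the
    whole space or (being closed) locally empty, and so is the composition. *)
Lemma composition_frontier S (Iplus Iminus : set 'I_n) x :
  (forall j, closed (S j)) -> (forall j, S j x -> (S j)° x) ->
  closure (composition S Iplus Iminus) x -> (composition S Iplus Iminus)° x.
Proof.
move=> Sc Sx Cx.
have [j jI jx] : (\bigcup_(j in Iplus) S j) x.
  have : closed (\bigcup_(j in Iplus) S j) 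
    by apply: closed_bigcup => [|k _]; [exact: finite_finset|exact: Sc].
  apply; apply: closure_subset Cx; exact: subDsetl.
have Mx : ~ (\bigcup_(j in Iminus) S j) x.
  move=> [k kI kx]; have [y [[_ yM] ky]] := Cx _ (Sx _ kx).
  by apply: yM; exists k.
have Mc : closed (\bigcup_(j in Iminus) S j) 
    by apply: closed_bigcup => [|k _]; [exact: finite_finset|exact: Sc].
have Mx' : nbhs x (~` (\bigcup_(j in Iminus) S j)).
  by apply: open_nbhs_nbhs; split => //; exact: closed_openC.
apply: filterS (filterI (Sx _ jx) Mx') => y [jy My].
by split => //; exists j.
Qed.

End composition_frontier.

(** * The cost and its lower bound *)

Section integral_equality.
Context {disp : measure_display} {T : measurableType disp} {R : realType}.
Variables (mu : {measure set T -> \bar R}) (D : set T) (f g : T -> R).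
Hypotheses (mD : measurable D)
  (fi : mu.-integrable D (EFin \o f)) (gi : mu.-integrable D (EFin \o g))
  (fg : forall x, D x -> f x <= g x).

(** The difference [g - f] is nonnegative, so its integral vanishes only if it
    is zero almost everywhere; finiteness of both integrals lets the hypothesis
    be subtracted. *)
Lemma ge_integral_ae_eqP :
  (\int[mu]_(x in D) (g x)%:E <= \int[mu]_(x in D) (f x)%:E)%E <->
  {ae mu, forall x, D x -> g x = f x}.
Proof.
have mfE : measurable_fun D (EFin \o f) by exact: measurable_int fi.
have mgE : measurable_fun D (EFin \o g) by exact: measurable_int gi.
split=> [gf|gf]; last first.
  rewrite (@ae_eq_integral _ _ _ mu D (EFin \o f) (EFin \o g))//.
  by apply: filterS gf => x gf Dx /=; rewrite gf.
have gf0 : (\int[mu]_(x in D) ((g x)%:E - (f x)%:E) = 0)%E.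
  rewrite integralB//.
  have -> : (\int[mu]_(x in D) (g x)%:E = \int[mu]_(x in D) (f x)%:E)%E.
    apply/eqP; rewrite eq_le gf/=.
    by apply: le_integral => // x /set_mem; exact: fg.
  by rewrite subee//; exact: integrable_fin_num.
have mgf : measurable_fun D (fun x => ((g x)%:E - (f x)%:E)%E).
  exact: emeasurable_funB.
have /(ae_eq_integral_abs mu mD mgf) :
    (\int[mu]_(x in D) `|(g x)%:E - (f x)%:E| = 0)%E.
  rewrite -gf0; apply: eq_integral => x /set_mem Dx.
  by rewrite gee0_abs// sube_ge0// lee_fin fg.
by apply: filterS => x + Dx => /(_ Dx) -[]/eqP; rewrite subr_eq0 => /eqP.
Qed.

End integral_equality.

Section integrand.
Context {R : realType}.
Implicit Types p l M : R.

Definition integrand p l : R := Num.max (p * l) (neg_part p).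

Lemma neg_part_min p : neg_part p = Num.min p 0.
Proof. by rewrite /neg_part minEle; case: (ltgtP p 0) => // ->. Qed.

Lemma integrand_lt0P p l : p < 0 -> integrand p l = neg_part p <-> 1 <= l.
Proof.
move=> p0; rewrite /integrand /neg_part p0; split=> [/max_idPr pl|l1].
  by rewrite -(ler_nM2l p0) mulr1.
by apply/max_idPr; rewrite -[leRHS]mulr1 ler_nM2l.
Qed.

Lemma integrand_gt0P p l : 0 < p -> integrand p l = neg_part p <-> l <= 0.
Proof.
move=> p0; rewrite /integrand /neg_part ltNge (ltW p0)/=.
split=> [/max_idPr|l0].
  by rewrite pmulr_rle0.
by apply/max_idPr; rewrite pmulr_rle0.
Qed.

Lemma norm_integrand_le p l M : `|l| <= M -> `|integrand p l| <= (M + 1) * `|p|.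
Proof.
move=> lM; have M0 : 0 <= M by rewrite (le_trans _ lM).
rewrite /integrand /neg_part maxEle; case: ifP => _; last first.
  by rewrite normrM mulrC ler_wpM2r// ler_wpDr.
case: ifP => _; last by rewrite normr0 mulr_ge0// addr_ge0.
by rewrite ler_peMl// ler_wpDl.
Qed.

End integrand.

Section cost.
Context {R : realType} {d n : nat}.
Variables (D : set 'rV[R]_d) (Pin Pex : 'rV[R]_d -> R).
Variables (S : 'I_n -> set 'rV[R]_d) (Sigma : set 'rV[R]_d).
Hypothesis mD : measurable (D : set (lebesgue_rV R d)).
Hypothesis Pint : (lebesgue R d).-integrable D (fun x => (Pin x - Pex x)%:E).
Hypothesis Sclosed : forall j, closed (S j).
Hypothesis LOC : lucid_object_condition D Pin Pex Sigma.
Implicit Types alpha : 'rV[R]_n.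

Lemma calL_measurable alpha (A : set (lebesgue_rV R d)) :
  measurable_fun A (calL S alpha : lebesgue_rV R d -> R).
Proof.
apply: measurable_sum => j; apply: measurable_funM => //.
by apply: measurable_indic; exact: closed_lebesgue_measurable.
Qed.

Lemma norm_calL_le alpha x : `|calL S alpha x| <= \sum_(j < n) `|alpha ord0 j|.
Proof.
rewrite (le_trans (ler_norm_sum _ _ _))//; apply: ler_sum => j _.
by rewrite normrM ler_piMr// indicE; case: (x \in S j); rewrite ?normr1 ?normr0.
Qed.

Lemma Pdiff_measurable :
  measurable_fun (D : set (lebesgue_rV R d)) (fun x => Pin x - Pex x).
Proof. by apply/measurable_EFinP; exact: measurable_int Pint. Qed.

Lemma neg_part_integrable :
  (lebesgue R d).-integrable D (EFin \o (fun x => neg_part (Pin x - Pex x))).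
Proof.
apply: le_integrable Pint => //.
  apply/measurable_EFinP; under eq_fun do rewrite neg_part_min.
  by apply: measurable_minr => //; exact: Pdiff_measurable.
move=> x _ /=; rewrite lee_fin /neg_part; case: ifP => // _.
by rewrite normr0.
Qed.

(** [calL] is bounded, being a finite combination of indicators, so the
    integrand is dominated by a multiple of [Pin - Pex]. *)
Lemma integrand_integrable alpha : (lebesgue R d).-integrable D
  (EFin \o (fun x => integrand (Pin x - Pex x) (calL S alpha x))).
Proof.
set M := \sum_(j < n) `|alpha ord0 j|.
apply: le_integrable (integrableZl mD (M + 1) Pint) => //.
  apply/measurable_EFinP; apply: measurable_maxr.
    by apply: measurable_funM; [exact: Pdiff_measurable|exact: calL_measurable].
  by apply/measurable_EFinP; exact: measurable_int neg_part_integrable.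
move=> x _ /=; rewrite lee_fin normrM [`|M + 1|]ger0_norm.
  exact/norm_integrand_le/norm_calL_le.
by rewrite addr_ge0// sumr_ge0.
Qed.

Definition min_cost : \bar R :=
  \int[lebesgue R d]_(x in D) (neg_part (Pin x - Pex x))%:E.

Definition separates alpha : Prop := {ae lebesgue R d, forall x, D x ->
  (Sigma x -> 1 <= calL S alpha x) /\ (~ Sigma x -> calL S alpha x <= 0)}.

Lemma min_cost_le alpha : (min_cost <= cost D Pin Pex S alpha)%E.
Proof.
apply: le_integral => //; first exact: neg_part_integrable.
  exact: integrand_integrable.
by move=> x _; rewrite lee_fin /integrand le_max lexx orbT.
Qed.

(** The lucid object condition forces [Pin x - Pex x] to be nonzero on [D], with
    a sign telling [Sigma] from its complement; hence the pointwise equality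
    case of the bound decides the position of [calL] on either side. *)
Lemma cost_le_min_costP alpha :
  (cost D Pin Pex S alpha <= min_cost)%E <-> separates alpha.
Proof.
rewrite /cost /min_cost.
have -> := @ge_integral_ae_eqP _ _ _ (lebesgue R d) D _
  (fun x => integrand (Pin x - Pex x) (calL S alpha x)) mD
  neg_part_integrable (integrand_integrable alpha); last first.
  by move=> x _; rewrite /integrand le_max lexx orbT.
have [Lin Lex] := LOC.
(* Points range over ['rV[R]_d] and the filter over its alias carrying the
   Lebesgue sigma-algebra, so the instance has to be given explicitly. *)
have aeF := ae_filter_ringOfSetsType (lebesgue R d).
have neg x : Sigma x -> Pin x - Pex x < 0 by rewrite subr_lt0; exact: Lin.
have pos x : D x -> ~ Sigma x -> 0 < Pin x - Pex x.
  by move=> Dx Sx; rewrite subr_gt0; exact: Lex.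
split=> h; apply: filterS h => x + Dx => /(_ Dx) h.
  split=> Sx; first exact: (integrand_lt0P _ (neg _ Sx)).1.
  exact: (integrand_gt0P _ (pos _ Dx Sx)).1.
have [Sx|Sx] := pselect (Sigma x).
  exact: (integrand_lt0P _ (neg _ Sx)).2 (h.1 Sx).
exact: (integrand_gt0P _ (pos _ Dx Sx)).2 (h.2 Sx).
Qed.

End cost.

(** * Coefficients of a composition *)

Section composition_coefficients.
Context {R : realType} {d n : nat}.
Variables (S : 'I_n -> set 'rV[R]_d) (Iplus Iminus : set 'I_n).

(** Each subtracted shape gets a weight large enough to cancel all the added
    shapes together. *)
Definition composition_coef : 'rV[R]_n :=
  \row_j (if `[< Iminus j >] then - n%:R else (`[< Iplus j >])%:R).

Lemma calL_composition_ge1 x :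
  composition S Iplus Iminus x -> 1 <= calL S composition_coef x.
Proof.
move=> [[k Ik kx] Mx].
have coefE j : composition_coef ord0 j * \1_(S j) x =
    (`[< Iplus j >])%:R * \1_(S j) x.
  rewrite mxE; case: asboolP => // Ij.
  by rewrite indicE memNset ?mulr0// => jx; apply: Mx; exists j.
rewrite /calL (eq_bigr _ (fun j _ => coefE j)) (bigD1 k)//= asboolT// mul1r.
by rewrite indicE mem_set// lerDl sumr_ge0.
Qed.

Lemma calL_composition_le0 x :
  ~ composition S Iplus Iminus x -> calL S composition_coef x <= 0.
Proof.
move=> Cx; rewrite /calL.
have [[k Ik kx]|Mx] := pselect ((\bigcup_(j in Iminus) S j) x).
  rewrite (bigD1 k)//= mxE asboolT// indicE mem_set// mulr1 addrC subr_le0.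
  apply: (@le_trans _ _ (\sum_(j < n | j != k) 1)).
    apply: ler_sum => j _; rewrite mxE indicE.
    have n1 : - n%:R <= 1 :> R by rewrite (le_trans _ ler01)// oppr_le0.
    by case: asboolP => _; last case: asboolP => _;
      case: (x \in S j); rewrite ?mulr1 ?mulr0.
  by rewrite sumr_const ler_nat (leq_trans (max_card _))// card_ord.
apply: sumr_le0 => j _; rewrite mxE indicE.
case: asboolP => _; first by rewrite mulNr oppr_le0 mulr_ge0.
case: asboolP => [Ij|_]; last by rewrite mul0r.
by rewrite memNset ?mulr0// => jx; apply: Cx; split => //; exists j.
Qed.

End composition_coefficients.

(** * Minimizers of the cost *)

Theorem theorem3p9 (R : realType) (d n : nat) (D : set 'rV[R]_d)
    (Pin Pex : 'rV[R]_d -> R) (S : 'I_n -> set 'rV[R]_d)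
    (Sigma : set 'rV[R]_d)
    (hD : imaging_domain D)
    (hPin : forall x, D x -> 0 <= Pin x)
    (hPex : forall x, D x -> 0 <= Pex x)
    (hint : (lebesgue R d).-integrable D (fun x => (Pin x - Pex x)%:E))
    (hS : forall j, is_shape D (S j))
    (hSigma : Sigma `<=` D)
    (hLOC : lucid_object_condition D Pin Pex Sigma)
    (hcomp : exists Iplus Iminus : set 'I_n,
       Sigma = closure (composition S Iplus Iminus))
    (alphastar : 'rV[R]_n) :
  (forall alpha : 'rV[R]_n,
     (cost D Pin Pex S alphastar <= cost D Pin Pex S alpha)%E) <->
  ({ae lebesgue R d, forall x, Sigma° x -> 1 <= calL S alphastar x} /\
   {ae lebesgue R d, forall x, (D `\` Sigma)° x -> calL S alphastar x <= 0}).
Proof.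
have [mD nfD] := hD.
have Sc j : closed (S j) by have [] := hS j.
have [Ip [Im SE]] := hcomp.
have aeF := ae_filter_ringOfSetsType (lebesgue R d).
(* The sets involved agree with their interiors off the null frontiers. *)
have frontier : {ae lebesgue R d, forall x, forall j, S j x -> (S j)° x}.
  apply: (@filter_forall _ _ _ _ aeF) => j.
  have [_ _ _ /null_frontier_negligible] := hS j.
  apply: negligibleS => x /= /not_implyP[Sx Sx']; split => //.
have Sint : {ae lebesgue R d, forall x, Sigma x -> (composition S Ip Im)° x}.
  apply: (@filterS _ _ aeF) frontier => x xS; rewrite SE.
  exact: (composition_frontier Sc xS).
have Dint : {ae lebesgue R d, forall x, (D `\` Sigma) x -> (D `\` Sigma)° x}.
  apply: negligibleS (null_frontier_negligible nfD).
  move=> x /= /not_implyP[[Dx Sx] DSx]; split => // Dx'; apply: DSx.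
  have Sx' : nbhs x (~` Sigma).
    apply: open_nbhs_nbhs; split => //; apply: closed_openC; rewrite SE.
    exact: closed_closure.
  exact: filterI.
have sepP alpha : separates D S Sigma alpha <->
    {ae lebesgue R d, forall x, Sigma° x -> 1 <= calL S alpha x} /\
    {ae lebesgue R d, forall x, (D `\` Sigma)° x -> calL S alpha x <= 0}.
  split=> [sep|[sepS sepD]].
    split; apply: (@filterS _ _ aeF) sep => x sep.
      by move=> /interior_subset Sx; apply: (sep _).1 => //; exact: hSigma.
    by move=> /interior_subset[Dx Sx]; exact: (sep Dx).2.
  have sep := @filterI _ _ aeF _ _ sepS sepD.
  have int := @filterI _ _ aeF _ _ Sint Dint.
  apply: (@filterS2 _ _ aeF) sep int => x [xS xD] [Si Di] Dx.
  split=> Sx; last by apply: xD; exact: Di.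
  apply: xS; apply: filterS (Si Sx) => y Cy; rewrite SE; exact: subset_closure.
have coef_sep : separates D S Sigma (composition_coef Ip Im).
  apply: (@filterS _ _ aeF) Sint => x Si Dx; split=> Sx.
    by apply: calL_composition_ge1; exact: interior_subset (Si Sx).
  apply: calL_composition_le0 => Cx; apply: Sx; rewrite SE.
  exact: subset_closure.
rewrite -sepP -(cost_le_min_costP mD hint Sc hLOC); split=> [amin|amin alpha].
  apply: (le_trans (amin (composition_coef Ip Im))).
  exact/(cost_le_min_costP mD hint Sc hLOC).
exact: le_trans amin (min_cost_le mD hint Sc alpha).
Qed.
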